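(* Let $p,q\geq 3$ be integers. The graph $C_p\,\square\, C_q$ has the PMH--property if and only if $p=q=4$.
   Context: All graphs are finite, simple and connected. $C_n$ denotes the cycle on $n$ vertices. The Cartesian product $G\,\square\, H$ of graphs $G$ and $H$ has vertex set $V(G)\times V(H)$, where $(u,v)$ and $(u',v')$ are adjacent if and only if either $u=u'$ and $vv'\in E(H)$, or $uu'\in E(G)$ and $v=v'$. A perfect matching $M$ of a graph $G$ can be extended to a Hamiltonian cycle if there exists a perfect matching $N$ of $G$ such that $M\cup N$ is (the edge set of) a Hamiltonian cycle of $G$. A graph has the PMH--property (Perfect--Matching--Hamiltonian property) if it admits at least one perfect matching and every perfect matching of it can be extended to a Hamiltonian cycle; in particular, a graph with no perfect matching does not have the PMH--property. *)

(* Defs.v *)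
From mathcomp Require Import all_boot.
Set Implicit Arguments. Unset Strict Implicit. Unset Printing Implicit Defensive.

(* Simple graphs: a symmetric irreflexive relation on a finite vertex type.
   Edges are represented as 2-element vertex sets {x, y}. *)
Section Graphs.
Variable T : finType.
Variable e : rel T.

Definition is_edge (E : {set T}) : bool :=
  [exists x, exists y, e x y && (E == [set x; y])].

Definition perfect_matching (M : {set {set T}}) : Prop :=
  (forall E, E \in M -> is_edge E) /\
  (forall x : T, #|[set E in M | x \in E]| = 1).

Definition ham_cycle_edges (H : {set {set T}}) : Prop :=
  exists s : seq T,
    [/\ uniq s, (forall x : T, x \in s), 3 <= size s, cycle e s &
        H = [set [set x; next s x] | x in s]].

Definition extends_to_ham (M : {set {set T}}) : Prop :=
  exists N : {set {set T}}, perfect_matching N /\ ham_cycle_edges (M :|: N).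

Definition PMH_property : Prop :=
  (exists M, perfect_matching M) /\
  (forall M, perfect_matching M -> extends_to_ham M).
End Graphs.

(* The cycle C_n on vertex set 'I_n (meaningful as a simple graph for n >= 3). *)
Definition cycle_graph (n : nat) : rel 'I_n :=
  fun i j => (val j == (val i).+1 %% n) || (val i == (val j).+1 %% n).

Definition box_product (T1 T2 : finType) (e1 : rel T1) (e2 : rel T2)
  : rel (T1 * T2)%type :=
  fun u v => ((u.1 == v.1) && e2 u.2 v.2) || (e1 u.1 v.1 && (u.2 == v.2)).
Arguments cycle_graph n : clear implicits.

(* Main.v *)
Require Import Defs.
From mathcomp Require Import all_boot all_order all_algebra.
From mathcomp Require Import zify.
Set Implicit Arguments. Unset Strict Implicit. Unset Printing Implicit Defensive.

(** If p and q are odd there is no perfect matching, and C_4 x C_4 is settled by a search over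
    its 272 perfect matchings. Otherwise let q be even and colour (i, j) by the parity of i + j.
    In a brickwork matching M every white vertex is matched to the right, so for any N the
    strands of M + N, with M directed from white to black and N from black to white, never go
    left, and an invariant of a strand is obtained by counting strands above and below it.
    For odd p take bricks in all rows. The colours clash between rows p - 1 and 0; where strands
    cross this seam, one leaves at the top of the stack and one at the bottom, so
    |#below - #above| is constant along M + N. Comparing two columns shows that the seam is never
    crossed; then the signed difference is constant, although top and bottom strands differ.
    For even p >= 6 take bricks in rows 1, ..., p - 2 and vertical edges between rows p - 1 and 0.
    The flow across these vertical edges cancels, so the height function of the flow is
    constant along M + N modulo the total rightward flow a. Consecutive strands differ by 1 in
    height, so a is 1 or -1; but the brick rows contribute at least 2 to a, which forces all
    N-edges in rows 0 and p - 1 to be horizontal, and these two rows are cut off. *)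

(** * Matchings and Hamiltonian cycles *)

Section Generic.
Variables (T : finType) (e : rel T).

(** Connectedness of the cycle. The invariants of strands constructed below enter through [f]. *)
Lemma ham_label_const (H : {set {set T}}) (X : eqType) (f : T -> X) :
  ham_cycle_edges e H ->
  (forall E x y, E \in H -> x \in E -> y \in E -> f x = f y) ->
  forall x y, f x = f y.
Proof.
case=> s [us sP ss cs ->] fH.
pose r := [rel x y | f x == f y].
have rtr : transitive r by move=> b a c /eqP ab /eqP bc; apply/eqP; rewrite ab.
have cyc : cycle r s.
  have sA : all [in s] s by apply/allP.
  apply: sub_in_cycle (sA) (cycle_next us) => x y xs ys /eqP <- /=.
  apply/eqP; apply: (fH [set x; next s x]); rewrite ?set21 ?set22 //.
  by apply/imsetP; exists x.
case: s us sP ss cs fH cyc => // x0 t us sP ss cs fH.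
rewrite /= => /(order_path_min rtr)/allP h.
have hx x : f x = f x0.
  have := sP x; rewrite inE => /orP[/eqP->//|xt].
  by apply/esym/eqP/h; rewrite mem_rcons inE xt orbT.
by move=> x y; rewrite !hx.
Qed.

Lemma pm_edge_uniq (M : {set {set T}}) E E' x :
  perfect_matching e M -> E \in M -> E' \in M -> x \in E -> x \in E' -> E = E'.
Proof.
case=> _ /(_ x)/eqP/cards1P[E0 EM] h h' xE xE'.
have : E \in [set E0] by rewrite -EM inE h.
have : E' \in [set E0] by rewrite -EM inE h'.
by rewrite !inE => /eqP-> /eqP->.
Qed.

Lemma pm_edgeP (M : {set {set T}}) x :
  perfect_matching e M -> exists2 E, E \in M & x \in E.
Proof.
case=> _ /(_ x)/eqP/cards1P[E0 EM].
by have := set11 E0; rewrite -EM inE => /andP[]; exists E0.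
Qed.

Lemma perfect_matchingI (M : {set {set T}}) :
  (forall E, E \in M -> is_edge e E) ->
  (forall x, exists2 E, E \in M /\ x \in E &
    forall E', E' \in M -> x \in E' -> E' = E) ->
  perfect_matching e M.
Proof.
move=> hE hx; split=> // x; have [E [EM xE] uE] := hx x.
apply/eqP/cards1P; exists E; apply/setP => E'; rewrite !inE.
by apply/andP/eqP => [[]|->]; first exact: uE.
Qed.

Hypothesis (esym : symmetric e) (eirr : irreflexive e).

Lemma is_edge_end E x : is_edge e E -> x \in E -> exists2 y, e x y & E = [set x; y].
Proof.
case/existsP=> a /existsP[b /andP[ab /eqP->]].
by rewrite !inE => /orP[]/eqP->; [exists b|exists a]; rewrite // 1?esym // setUC.
Qed.

Lemma card_is_edge E : is_edge e E -> #|E| = 2.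
Proof.
case/existsP=> a /existsP[b /andP[ab /eqP->]].
by rewrite cards2; case: eqP ab => // ->; rewrite eirr.
Qed.

(** Double counting of the incidences between vertices and edges of [M]. *)
Lemma pm_even (M : {set {set T}}) : perfect_matching e M -> ~~ odd #|T|.
Proof.
move=> [ME Mx].
have : \sum_(x : T) #|[set E in M | x \in E]| = \sum_(E in M) #|E|.
  under eq_bigr => x _ do rewrite -sum1_card big_mkcond /=.
  rewrite exchange_big /= [RHS]big_mkcond /=; apply: eq_bigr => E _.
  case: ifPn => EM; last by rewrite big1 // => x _; rewrite inE (negPf EM).
  rewrite -sum1_card [RHS]big_mkcond /=; apply: eq_bigr => x _.
  by rewrite inE EM.
under eq_bigr => x _ do rewrite Mx.
under [RHS]eq_bigr => E EM do rewrite card_is_edge ?ME //.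
by rewrite sum1_card sum_nat_const => ->; rewrite muln2 odd_double.
Qed.

(* Each vertex lies on two edges of a Hamiltonian cycle H and on one of M, so H minus M is a
   perfect matching. *)
Lemma extends_to_hamI (M : {set {set T}}) s :
  perfect_matching e M -> uniq s -> (forall x, x \in s) -> 2 < size s -> cycle e s ->
  (forall E, E \in M -> exists2 x, E = [set x; next s x] & x \in s) ->
  extends_to_ham e M.
Proof.
move=> [ME Mx] us sP ss cs MH.
pose H := [set [set x; next s x] | x in s].
have sMH : M \subset H.
  by apply/subsetP => E /MH[x -> xs]; apply/imsetP; exists x.
have HE E : E \in H -> is_edge e E.
  case/imsetP => x xs ->; apply/existsP; exists x; apply/existsP; exists (next s x).
  by rewrite eqxx (next_cycle cs).
exists (H :\: M); split; last first.
  exists s; split=> //; rewrite -/H; apply/setP => E; rewrite !inE.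
  by case: (boolP (E \in M)) => //= /(subsetP sMH)->.
split=> [E|x]; first by rewrite inE => /andP[_ /HE].
(* The cycle has length at least 3, so the successor and the predecessor of [x] differ and exactly
   two edges of [H] meet [x]. *)
have npx : next s x != prev s x.
  apply/eqP => h; have [i t st] := rot_to (sP x).
  have := next_prev us x; rewrite -h -!(next_rot i us) st.
  have : uniq (x :: t) by rewrite -st rot_uniq.
  have : 2 < size (x :: t) by rewrite -st size_rot.
  case: t {st} => [|y [|z t]] //= _; rewrite !inE !negb_or eqxx.
  case/andP=> /and3P[xy xz _] _; rewrite eq_sym (negPf xy) eqxx => zx.
  by rewrite zx eqxx in xz.
have -> : [set E in H :\: M | x \in E] = [set E in H | x \in E] :\: [set E in M | x \in E].
  by apply/setP => E; rewrite !inE; case: (x \in E); rewrite ?andbT ?andbF.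
rewrite cardsD (setIidPr _); last first.
  by apply/subsetP => E; rewrite !inE => /andP[/(subsetP sMH)-> ->].
rewrite Mx.
have -> : [set E in H | x \in E] = [set [set x; next s x]; [set x; prev s x]].
  apply/setP => E; rewrite !inE; apply/andP/orP.
    case=> /imsetP[y ys ->]; rewrite !inE => /orP[]/eqP xy.
      by left; rewrite xy.
    by right; rewrite xy prev_next // setUC.
  case=> /eqP->; rewrite set21; split=> //; apply/imsetP.
    by exists x.
  by exists (prev s x); rewrite // next_prev // setUC.
rewrite cards2; case: eqP => // h.
have : next s x \in [set x; prev s x] by rewrite -h set22.
rewrite !inE (negPf npx) orbF => /eqP nx.
by have := next_cycle cs (sP x); rewrite nx eirr.
Qed.

End Generic.

(** * Torus grids *)

(* A p x q torus grid with its vertices indexed by all of nat * nat, modulo p and q. *)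
Record grid (T : finType) (e : rel T) (p q : nat) (v : nat -> nat -> T)
    (c : T -> nat * nat) : Prop := Grid {
  grid_eq : forall i j i' j',
    (v i j == v i' j') = (i == i' %[mod p]) && (j == j' %[mod q]);
  grid_coord : forall x, [/\ (c x).1 < p, (c x).2 < q & v (c x).1 (c x).2 = x];
  grid_sym : symmetric e;
  grid_adj : forall i j w, e (v i.+1 j.+1) w =
    (w \in [:: v i.+1 j; v i.+1 j.+2; v i j.+1; v i.+2 j.+1]) }.

Lemma eqn_modS p i j : (i.+1 == j.+1 %[mod p]) = (i == j %[mod p]).
Proof. by rewrite -(addn1 i) -(addn1 j) eqn_modDr. Qed.

Lemma eqn_modS0 p i : 1 < p -> (i.+1 == i %[mod p]) = false.
Proof.
move=> p1; rewrite -addn1 -[X in _ == X %[mod p]]addn0 eqn_modDl.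
by rewrite mod0n modn_small.
Qed.

Lemma eqn_modSS0 p i : 2 < p -> (i.+2 == i %[mod p]) = false.
Proof.
move=> p2; rewrite -addn2 -[X in _ == X %[mod p]]addn0 eqn_modDl.
by rewrite mod0n modn_small.
Qed.

Section GridTheory.
Variables (T : finType) (e : rel T) (p q : nat) (v : nat -> nat -> T) (c : T -> nat * nat).
Hypotheses (G : grid e p q v c) (p2 : 2 < p) (q2 : 2 < q).

Definition hedge i j := [set v i j; v i j.+1].
Definition vedge i j := [set v i j; v i.+1 j].

Lemma grid_modl i j : v (i %% p) j = v i j.
Proof. by apply/eqP; rewrite (grid_eq G) modn_mod !eqxx. Qed.

Lemma grid_modr i j : v i (j %% q) = v i j.
Proof. by apply/eqP; rewrite (grid_eq G) modn_mod !eqxx. Qed.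

Lemma grid_eqP i j i' j' : reflect (i = i' %[mod p] /\ j = j' %[mod q]) (v i j == v i' j').
Proof. by rewrite (grid_eq G); apply: (iffP andP) => -[/eqP ? /eqP ?]. Qed.

Lemma grid_coord1 i j : (c (v i j)).1 = i %% p.
Proof.
have [i_p _ /eqP] := grid_coord G (v i j).
by case/grid_eqP => <- _; rewrite modn_small.
Qed.

Lemma grid_coord2 i j : (c (v i j)).2 = j %% q.
Proof.
have [_ j_q /eqP] := grid_coord G (v i j).
by case/grid_eqP => _ <-; rewrite modn_small.
Qed.

(** [grid_adj] speaks only of successor indices, which avoids predecessors modulo [p] and [q];
    shifting by a full period brings any vertex into this form. *)
Lemma grid_surjS x : exists i j, x = v i.+1 j.+1.
Proof.
have [_ _ <-] := grid_coord G x; exists ((c x).1 + p.-1), ((c x).2 + q.-1).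
apply/eqP/grid_eqP; rewrite -!addnS !prednK ?modnDr //; lia.
Qed.

Lemma grid_irr : irreflexive e.
Proof.
move=> x; have [i [j ->]] := grid_surjS x; rewrite (grid_adj G) !inE.
by rewrite !(grid_eq G) !eqn_modS ?eqn_modS0 ?(eq_sym (_ %% _) (_.+1 %% _)) ?eqn_modS0 ?andbF //; lia.
Qed.

Lemma grid_hedge i j : e (v i j) (v i j.+1).
Proof.
have [a [b E]] := grid_surjS (v i j).
have /grid_eqP[ia jb] : v i j == v a.+1 b.+1 by rewrite E.
rewrite E (grid_adj G) !inE; apply/orP; right; apply/orP; left.
by apply/grid_eqP; split=> //; apply/eqP; rewrite eqn_modS jb.
Qed.

Lemma grid_vedge i j : e (v i j) (v i.+1 j).
Proof.
have [a [b E]] := grid_surjS (v i j).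
have /grid_eqP[ia jb] : v i j == v a.+1 b.+1 by rewrite E.
rewrite E (grid_adj G) !inE; do 3 (apply/orP; right).
by apply/grid_eqP; split=> //; apply/eqP; rewrite eqn_modS ia.
Qed.

Lemma grid_nbrs_uniq i j : uniq [:: v i.+1 j; v i.+1 j.+2; v i j.+1; v i.+2 j.+1].
Proof.
have symm n a b : (a %% n == b %% n) = (b %% n == a %% n) by rewrite eq_sym.
rewrite /= !inE !(grid_eq G) !eqn_modS !eqxx !(symm _ j j.+2) !(symm _ j j.+1) !(symm _ i i.+1) !(symm _ i i.+2).
by rewrite !eqn_modSS0 ?eqn_modS0 //; lia.
Qed.

(** As [p, q > 2], the four neighbours are distinct, so these are four different edges. The flow
    arguments start from this exact-cover equation. *)
Lemma pm_grid (N : {set {set T}}) i j : perfect_matching e N ->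
  (hedge i.+1 j \in N) + (hedge i.+1 j.+1 \in N)
  + (vedge i j.+1 \in N) + (vedge i.+1 j.+1 \in N) = 1.
Proof.
move=> pN; set x := v i.+1 j.+1.
have [E EN xE] := pm_edgeP x pN.
have [y exy Exy] := is_edge_end (grid_sym G) (pN.1 E EN) xE.
have nb z : e x z -> ([set x; z] \in N) = (z == y).
  move=> exz; apply/idP/eqP => [zN|->]; last by rewrite -Exy.
  have Ez : [set x; z] = [set x; y] by rewrite -Exy; apply: (pm_edge_uniq pN zN EN (set21 _ _) xE).
  have : z \in [set x; y] by rewrite -Ez set22.
  by rewrite !inE => /orP[]/eqP // zx; move: exz; rewrite zx grid_irr.
rewrite /hedge /vedge (setUC [set v i.+1 j]) (setUC [set v i j.+1]) -/x.
rewrite !nb ?(grid_adj G) ?inE ?eqxx ?orbT //.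
move: exy; rewrite (grid_adj G) => yin.
by have := count_uniq_mem y (grid_nbrs_uniq i j); rewrite yin /= addn0 !addnA.
Qed.

(** * Matchings given by periodic indicators of horizontal ([RM]) and vertical ([UM]) edges *)

Section Brick.
Variables RM UM : nat -> nat -> bool.
Hypothesis RM_mod : forall i j, RM (i %% p) (j %% q) = RM i j.
Hypothesis UM_mod : forall i j, UM (i %% p) (j %% q) = UM i j.
Hypothesis RUM : forall i j, RM i.+1 j + RM i.+1 j.+1 + UM i j.+1 + UM i.+1 j.+1 = 1.

Definition grid_matching : {set {set T}} :=
  [set E | [exists i : 'I_p, exists j : 'I_q,
     (RM i j && (E == hedge i j)) || (UM i j && (E == vedge i j))]].

Lemma grid_matchingP E : reflect
  (exists i j, (RM i j /\ E = hedge i j) \/ (UM i j /\ E = vedge i j)) (E \in grid_matching).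
Proof.
rewrite inE; apply: (iffP existsP).
  case=> i /existsP[j /orP[]/andP[h /eqP->]]; exists i, j; by [left|right].
have p0 : 0 < p by lia. have q0 : 0 < q by lia.
case=> i [j h]; exists (Ordinal (ltn_pmod i p0)); apply/existsP.
exists (Ordinal (ltn_pmod j q0)); rewrite /= RM_mod UM_mod /hedge /vedge.
have -> : v (i %% p) (j %% q) = v i j by rewrite grid_modl grid_modr.
have -> : v (i %% p) (j %% q).+1 = v i j.+1.
  by apply/eqP; rewrite (grid_eq G) eqn_modS !modn_mod !eqxx.
have -> : v (i %% p).+1 (j %% q) = v i.+1 j.
  by apply/eqP; rewrite (grid_eq G) eqn_modS !modn_mod !eqxx.
by case: h => -[-> ->]; rewrite /= eqxx ?orbT.
Qed.

Lemma grid_matching_pm : perfect_matching e grid_matching.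
Proof.
apply: perfect_matchingI => [E /grid_matchingP[i [j [][_ ->]]]|x].
- by apply/existsP; exists (v i j); apply/existsP; exists (v i j.+1); rewrite grid_hedge eqxx.
- by apply/existsP; exists (v i j); apply/existsP; exists (v i.+1 j); rewrite grid_vedge eqxx.
have [i [j ->]] := grid_surjS x.
have inc E : E \in grid_matching -> v i.+1 j.+1 \in E ->
    (RM i.+1 j /\ E = hedge i.+1 j \/ RM i.+1 j.+1 /\ E = hedge i.+1 j.+1) \/
    (UM i j.+1 /\ E = vedge i j.+1 \/ UM i.+1 j.+1 /\ E = vedge i.+1 j.+1).
  have cong a b a' b' : a = a' %[mod p] -> b = b' %[mod q] ->
    [/\ RM a b = RM a' b', UM a b = UM a' b', hedge a b = hedge a' b' & vedge a b = vedge a' b'].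
    move=> ha hb; split; first by rewrite -RM_mod ha hb RM_mod.
    + by rewrite -UM_mod ha hb UM_mod.
    + by congr [set _; _]; apply/eqP/grid_eqP; split=> //; apply/eqP; rewrite eqn_modS hb.
    + by congr [set _; _]; apply/eqP/grid_eqP; split=> //; apply/eqP; rewrite eqn_modS ha.
  case/grid_matchingP=> a [b [][h ->]]; rewrite !inE !(grid_eq G) => /orP[]/andP[/eqP ia /eqP jb].
  - by left; right; have [<- _ <- _] := cong _ _ _ _ (esym ia) (esym jb).
  - have jb' : b = j %[mod q] by apply/eqP; rewrite -eqn_modS jb.
    by left; left; have [<- _ <- _] := cong _ _ _ _ (esym ia) jb'.
  - by right; right; have [_ <- _ <-] := cong _ _ _ _ (esym ia) (esym jb).
  - have ia' : a = i %[mod p] by apply/eqP; rewrite -eqn_modS ia.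
    by right; left; have [_ <- _ <-] := cong _ _ _ _ ia' (esym jb).
have R1 := RUM i j.
have [E [EM xE]] : exists E, E \in grid_matching /\ v i.+1 j.+1 \in E.
  case E1: (RM i.+1 j).
    by exists (hedge i.+1 j); rewrite set22; split=> //; apply/grid_matchingP; exists i.+1, j; left.
  case E2: (RM i.+1 j.+1).
    by exists (hedge i.+1 j.+1); rewrite set21; split=> //; apply/grid_matchingP; exists i.+1, j.+1; left.
  case E3: (UM i j.+1).
    by exists (vedge i j.+1); rewrite set22; split=> //; apply/grid_matchingP; exists i, j.+1; right.
  case E4: (UM i.+1 j.+1).
    by exists (vedge i.+1 j.+1); rewrite set21; split=> //; apply/grid_matchingP; exists i.+1, j.+1; right.
  by rewrite E1 E2 E3 E4 in R1.
exists E => // E' E'M xE'.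
case: (inc _ EM xE) => -[][h ->]; case: (inc _ E'M xE') => -[][h' ->] //;
  by rewrite h h' in R1; lia.
Qed.

Variable N : {set {set T}}.
Hypotheses (pN : perfect_matching e N) (hH : ham_cycle_edges e (grid_matching :|: N)).

(** A common edge [E] of both matchings would be a whole component of the union: membership in [E]
    would be constant along the cycle, yet [E] has two vertices and the graph at least three. *)
Lemma ham_grid_disjoint i j : RM i j && (hedge i j \in N) = false /\
  UM i j && (vedge i j \in N) = false.
Proof.
have pM := grid_matching_pm.
have no_common E : E \in grid_matching -> E \in N -> False.
  move=> EM EN; have cst := @ham_label_const _ _ _ _ (mem E) hH.
  have /cst h F x y : F \in grid_matching :|: N -> x \in F -> y \in F -> (mem E) x = (mem E) y.
    rewrite inE => FMN xF yF /=.
    have sub z : z \in F -> z \in E -> F = E.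
      by move=> zF zE; case/orP: FMN => h;
        [apply: (pm_edge_uniq pM h EM zF zE)|apply: (pm_edge_uniq pN h EN zF zE)].
    by apply/idP/idP => h; [rewrite -(sub x)|rewrite -(sub y)].
  have EE := pM.1 _ EM.
  have [a [b Eab]] := grid_matchingP _ EM.
  have Eall x : x \in E.
    have : v a b \in E by case: Eab => -[_ ->]; rewrite set21.
    by have /= -> := h (v a b) x.
  have : #|[set v 0 0; v 1 0; v 2 0]| <= #|E| by apply/subset_leq_card/subsetP => z _.
  rewrite (card_is_edge grid_irr EE) -setUA cardsU1 cards2 !inE !(grid_eq G) !eqn_modS !eqxx !andbT.
  rewrite !(eq_sym (0 %% p)) (eqn_modS0 0) ?(eqn_modSS0 0) //; lia.
split; apply/negbTE/negP => /andP[h hN]; apply: (no_common _ _ hN); apply/grid_matchingP;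
  exists i, j; by [left|right].
Qed.

(** Labels live on rows 0 to [p - 1] and are periodic only in the columns. Edges from row [p - 1]
    back to row 0 have a hypothesis of their own, because labels need separate treatment across this
    seam. *)
Lemma ham_grid_label (X : eqType) (L : nat -> nat -> X) :
  (forall i j, i < p -> L i (j + q) = L i j) ->
  (forall i j, i < p -> RM i j.+1 || (hedge i j.+1 \in N) -> L i j.+1 = L i j.+2) ->
  (forall i j, i.+1 < p -> UM i j.+1 || (vedge i j.+1 \in N) -> L i j.+1 = L i.+1 j.+1) ->
  (forall j, UM p.-1 j.+1 || (vedge p.-1 j.+1 \in N) -> L p.-1 j.+1 = L 0 j.+1) ->
  forall i j i' j', i < p -> i' < p -> L i j = L i' j'.
Proof.
move=> Lq Lh Lv Lw.
have p0 : 0 < p by lia. have q0 : 0 < q by lia.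
have Lmod i j : i < p -> L i (j %% q) = L i j.
  move=> ip; rewrite {2}(divn_eq j q) addnC; elim: (j %/ q) => [|k IH]; first by rewrite addn0.
  by rewrite mulSn addnCA addnC Lq.
pose f x := L (c x).1 (c x).2.
have fv i j : f (v i j) = L (i %% p) j.
  by rewrite /f grid_coord1 grid_coord2 Lmod // ltn_pmod.
(* Adding the period [q] turns the column into a successor, as the hypotheses on [L] require. *)
have fh i j : RM i j || (hedge i j \in N) -> f (v i j) = f (v i j.+1).
  have -> : hedge i j = hedge (i %% p) (j + q.-1).+1.
    by rewrite /hedge; congr [set _; _]; apply/eqP; rewrite (grid_eq G) ?eqn_modS modn_mod
      -addnS prednK // ?eqn_modS modnDr !eqxx.
  have -> : RM i j = RM (i %% p) (j + q.-1).+1.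
    by rewrite -RM_mod -[RHS]RM_mod -addnS prednK // modn_mod modnDr.
  have jE : (j + q.-1).+1 = j + q by rewrite -addnS prednK.
  move/(Lh _ _ (ltn_pmod i p0)); rewrite !fv jE -addSn !Lq //; exact: ltn_pmod.
have fu i j : UM i j || (vedge i j \in N) -> f (v i j) = f (v i.+1 j).
  have -> : vedge i j = vedge (i %% p) (j + q.-1).+1.
    by rewrite /vedge; congr [set _; _]; apply/eqP; rewrite (grid_eq G) ?eqn_modS modn_mod
      -addnS prednK // modnDr !eqxx.
  have -> : UM i j = UM (i %% p) (j + q.-1).+1.
    by rewrite -UM_mod -[RHS]UM_mod -addnS prednK // modn_mod modnDr.
  rewrite !fv => h.
  have im : i.+1 %% p = (i %% p).+1 %% p by rewrite -addn1 -[(i %% p).+1]addn1 modnDml.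
  have ip := ltn_pmod i p0.
  have Lj k : k < p -> L k (j + q.-1).+1 = L k j by move=> kp; rewrite -addnS prednK // Lq.
  case: (ltnP (i %% p).+1 p) => hi.
    by move: (Lv _ _ hi h); rewrite im (modn_small hi) !Lj.
  have ipE : i %% p = p.-1 by lia.
  move: h; rewrite im ipE prednK // modnn => /Lw; rewrite !Lj //; lia.
have cst := @ham_label_const _ _ _ _ f hH.
move=> i j i' j' ip ip'; rewrite -(modn_small ip) -(modn_small ip') -!fv.
apply: cst => E x y EMN.
have fE : forall a b, f a = f b -> E = [set a; b] -> x \in E -> y \in E -> f x = f y.
  by move=> a b ab ->; rewrite !inE => /orP[]/eqP-> /orP[]/eqP->.
move: EMN; rewrite inE => /orP[/grid_matchingP[a [b [][h Eh]]]|EN].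
- by apply: fE Eh; apply: fh; rewrite h.
- by apply: fE Eh; apply: fu; rewrite h.
move=> xE; have [z exz Ez] := is_edge_end (grid_sym G) (pN.1 _ EN) xE.
move: xE; apply: (fE _ _ _ Ez); move: exz EN; rewrite Ez.
have [a [b ->]] := grid_surjS x; rewrite (grid_adj G) !inE => /or4P[]/eqP-> EN.
- by apply/esym/fh; rewrite /hedge setUC EN orbT.
- by apply/fh; rewrite /hedge EN orbT.
- by apply/esym/fu; rewrite /vedge setUC EN orbT.
- by apply/fu; rewrite /vedge EN orbT.
Qed.

End Brick.
End GridTheory.

(** * Brickwork on an odd number of rows *)

Section Flow.
Import GRing.Theory.
Local Open Scope ring_scope.
Variables (p : nat) (R U RM UM : nat -> nat -> bool).
Hypothesis RU : forall i j, (R i.+1 j + R i.+1 j.+1 + U i j.+1 + U i.+1 j.+1 = 1)%N.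
Hypothesis RU0 : forall j, (R 0%N j + R 0%N j.+1 + U p.-1 j.+1 + U 0%N j.+1 = 1)%N.
Hypothesis RUM : forall i j, (RM i.+1 j + RM i.+1 j.+1 + UM i j.+1 + UM i.+1 j.+1 = 1)%N.
Hypothesis RUM0 : forall j, (RM 0%N j + RM 0%N j.+1 + UM p.-1 j.+1 + UM 0%N j.+1 = 1)%N.

(* Call (i, j) black when i + j is even, and direct M-edges from white to black, the other
   edges from black to white. Then hflow i j is the rightward flow from (i, j) to (i, j + 1),
   and vflow i j the upward flow in column j across the line just below row i. Row 0 sits
   above row p - 1, but for odd p the colours clash there, so vflow 0 follows the colouring
   of row 0 and vflow p that of row p - 1. *)
Definition sgc (i j : nat) : int := if odd (i + j) then -1 else 1.
Definition hflow i j : int := sgc i j * ((R i j : nat)%:Z - (RM i j : nat)%:Z).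
Definition vflow i j : int :=
  if i is i'.+1 then sgc i' j * ((U i' j : nat)%:Z - (UM i' j : nat)%:Z)
  else - sgc 0%N j * ((U p.-1 j : nat)%:Z - (UM p.-1 j : nat)%:Z).
Definition flow i j : int := \sum_(k < i) hflow k j.

Lemma flow0 j : flow 0%N j = 0.
Proof. by rewrite /flow big_ord0. Qed.

Lemma flowS i j : flow i.+1 j = flow i j + hflow i j.
Proof. by rewrite /flow big_ord_recr. Qed.

(** Conservation at [(i, j + 1)]: the difference of the two exact-cover equations there, multiplied
    by the sign of the colour. *)
Lemma hflow_vflow i j : hflow i j.+1 = hflow i j + vflow i j.+1 - vflow i.+1 j.+1.
Proof.
rewrite /hflow /vflow /sgc; case: i => [|i].
  by have := RU0 j; have := RUM0 j; rewrite !addnS /=; case: (odd _) => /=; lia.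
by have := RU i j; have := RUM i j; rewrite !addnS !addSn /=; case: (odd _) => /=; lia.
Qed.

(** Conservation summed over the rows below [i]; the vertical terms telescope. *)
Lemma flow_vflow i j : flow i j.+1 = flow i j + vflow 0%N j.+1 - vflow i j.+1.
Proof.
elim: i => [|i IH]; first by rewrite !flow0; lia.
by rewrite !flowS IH hflow_vflow; lia.
Qed.

End Flow.


(** * The balance of a strand for odd [p] *)

Section OddFlow.
Import GRing.Theory.
Local Open Scope ring_scope.
Variables (p q : nat) (R U : nat -> nat -> bool).
Hypotheses (p2 : (2 < p)%N) (op : odd p) (oq : ~~ odd q).
Hypothesis RU : forall i j, (R i.+1 j + R i.+1 j.+1 + U i j.+1 + U i.+1 j.+1 = 1)%N.
Hypothesis RU0 : forall j, (R 0%N j + R 0%N j.+1 + U p.-1 j.+1 + U 0%N j.+1 = 1)%N.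
Hypothesis Rdisj : forall i j, (i < p)%N -> odd (i + j) -> R i j = false.
Hypothesis Rper : forall i j, R i (j + q)%N = R i j.

Let M i j := odd (i + j).
Let Z (i j : nat) := false.
Let F := hflow R M.
Let V := vflow p U Z.
Let S := flow R M.

(* Among the strands crossing the cut between columns j and j + 1, those below the strand in
   row i minus those above it. *)
Definition balance i j : int := S i j + S i.+1 j - S p j.
Local Notation D := balance.

Let p0 : (0 < p)%N. Proof. by case: p p2. Qed.

Let MZ i j : (M i.+1 j + M i.+1 j.+1 + Z i j.+1 + Z i.+1 j.+1 = 1)%N.
Proof. by rewrite /M /Z addnS /=; case: (odd _) => /=; lia. Qed.

Let MZ0 j : (M 0%N j + M 0%N j.+1 + Z p.-1 j.+1 + Z 0%N j.+1 = 1)%N.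
Proof. by rewrite /M /Z addnS /=; case: (odd _) => /=; lia. Qed.

(** M occupies the positions with [i + j] odd and N only positions with [i + j] even, so every
    horizontal edge is traversed rightwards and [F] counts strands. *)
Let FE i j : (i < p)%N -> F i j = (M i j || R i j : nat)%:Z.
Proof.
move=> ip; rewrite /F /hflow /sgc /M; case: (boolP (odd _)) => [/(Rdisj ip)->|_] /=; lia.
Qed.

Let VE i j : V i.+1 j = sgc i j * (U i j : nat)%:Z.
Proof. by rewrite /V /vflow /Z subr0. Qed.

Let V0E j : V 0%N j = - sgc 0 j * (U p.-1 j : nat)%:Z.
Proof. by rewrite /V /vflow /Z subr0. Qed.

Let VpE j : V p j = - V 0%N j.
Proof.
rewrite -{1}(prednK p0) VE V0E mulNr opprK; congr (_ * _).
rewrite /sgc; have -> // : odd (p.-1 + j) = odd (0 + j).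
by rewrite oddD; move: op; rewrite -{1}(prednK p0) /=; case: odd.
Qed.

Let SV i j : S i j.+1 = S i j + V 0%N j.+1 - V i j.+1.
Proof. exact: flow_vflow RU RU0 MZ MZ0 i j. Qed.

(** The seam terms cancel by [VpE], so only the vertical edges at [(i, j + 1)] remain. *)
Lemma balance_vflow i j : D i j.+1 = D i j - V i j.+1 - V i.+1 j.+1.
Proof. by rewrite /balance !SV VpE; lia. Qed.

Let SD i j : D i.+1 j = D i j + F i j + F i.+1 j.
Proof. by rewrite /balance /S !flowS -/F; lia. Qed.

Let Sper i j : (i <= p)%N -> S i (j + q) = S i j.
Proof.
elim: i => [|i IH] ip; first by rewrite /S !flow0.
rewrite /S !flowS -/S IH 1?ltnW // -/F !FE // Rper /M; congr (_ + (nat_of_bool (_ || _))%:Z).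
by rewrite addnA [LHS]oddD (negPf oq) addbF.
Qed.

Let Dper i j : (i < p)%N -> D i (j + q) = D i j.
Proof. by move=> ip; rewrite /balance !Sper // ltnW. Qed.

(* The balance of the strand through (i, j), read off at its M-edge; that edge leaves a black
   vertex to the left, and (j + q).-1 is the column j - 1 modulo q. *)
Definition odd_label i j := if odd (i + j) then D i j else D i (j + q).-1.
Local Notation L := odd_label.

Lemma odd_labelW i j : odd (i + j) -> L i j = D i j.
Proof. by rewrite /L => ->. Qed.

Lemma odd_labelB i j : (i < p)%N -> odd (i + j) -> L i j.+1 = D i j.
Proof. by move=> ip o; rewrite /L addnS /= o /= Dper. Qed.

Hypothesis q0 : (0 < q)%N.

Lemma odd_label_per i j : (i < p)%N -> L i (j + q) = L i j.
Proof.
move=> ip; rewrite /L addnA [odd (i + j + q)]oddD (negPf oq) addbF.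
by rewrite (_ : (j + q + q).-1 = (j + q).-1 + q)%N ?Dper //; lia.
Qed.

Let used0 i j : (i < p)%N -> R i j || R i j.+1 -> V i j.+1 = 0 /\ V i.+1 j.+1 = 0.
Proof.
case: i => [|i] ip rr.
  have [u1 u2] : U p.-1 j.+1 = false /\ U 0%N j.+1 = false by have := RU0 j; lia.
  by rewrite VE V0E u1 u2 !mulr0.
have [u1 u2] : U i j.+1 = false /\ U i.+1 j.+1 = false by have := RU i j; lia.
by rewrite !VE u1 u2 !mulr0.
Qed.

(** Both ends of an M-edge read [D] at that edge. The ends of an N-edge read [D] at columns [j] and
    [j + 2], and no vertical edge meets either end. *)
Lemma odd_label_h i j : (i < p)%N -> M i j.+1 || R i j.+1 -> L i j.+1 = L i j.+2.
Proof.
move=> ip; rewrite /M; case: (boolP (odd (i + j.+1))) => [o _|o /= r].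
  by rewrite odd_labelW // odd_labelB.
have o' : odd (i + j) by move: o; rewrite addnS /= negbK.
rewrite odd_labelB // odd_labelW ?addnS ?o' //; last by rewrite /= o'.
have [] : V i j.+1 = 0 /\ V i.+1 j.+1 = 0 by apply: used0; rewrite ?r ?orbT.
have [] : V i j.+2 = 0 /\ V i.+1 j.+2 = 0 by apply: used0; rewrite ?r.
by rewrite !balance_vflow => -> -> -> ->; rewrite !subr0.
Qed.

Let vused i j : (i.+1 < p)%N -> U i j.+1 ->
  [/\ V i j.+1 = 0, V i.+1 j.+1 = sgc i j.+1, V i.+2 j.+1 = 0, R i j = false & R i j.+1 = false].
Proof.
move=> ip u; have u3 : U i.+1 j.+1 = false by have := RU i j; lia.
rewrite !VE u u3 mulr1 mulr0; case: i ip u {u3} => [|i] ip u.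
  have [-> -> u1] : [/\ R 0%N j = false, R 0%N j.+1 = false & U p.-1 j.+1 = false].
    by have := RU0 j; split; lia.
  by rewrite V0E u1 mulr0.
have [-> -> u1] : [/\ R i.+1 j = false, R i.+1 j.+1 = false & U i j.+1 = false].
  by have := RU i j; split; lia.
by rewrite VE u1 mulr0.
Qed.

(** On both sides of column [j + 1] the strand is alone in rows [i] and [i + 1], so it passes no
    other strand when it changes rows. *)
Lemma odd_label_v i j : (i.+1 < p)%N -> U i j.+1 -> L i j.+1 = L i.+1 j.+1.
Proof.
move=> ip /(vused ip)[V1 V2 V3 r1 r2].
have Dv := balance_vflow i j; rewrite V1 V2 /sgc addnS /= in Dv.
case: (boolP (odd (i + j))) => o; rewrite ?o ?(negPf o) /= in Dv.
  rewrite odd_labelB 1?ltnW // odd_labelW ?addnS ?addSn /= ?negbK ?o //.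
  by rewrite SD (FE _ (ltnW ip)) (FE _ ip) r2 Dv /M !addnS !addSn /= o /=; lia.
rewrite odd_labelW ?addnS //= odd_labelB //.
by rewrite SD (FE _ (ltnW ip)) (FE _ ip) r1 Dv /M !addSn /= (negPf o) /=; lia.
Qed.


Let F0 i j : (i < p)%N -> 0 <= F i j.
Proof. by move=> ip; rewrite FE. Qed.

Let S_mono i k j : (i + k <= p)%N -> S i j <= S (i + k) j.
Proof.
elim: k => [|k IH] ik; first by rewrite addn0.
rewrite addnS in ik *; rewrite /S flowS -/S -/F.
by have := F0 j ik; have := IH (ltnW ik); lia.
Qed.

Let SpE j : S p j = S p.-1 j + F p.-1 j.
Proof. by rewrite -{1}(prednK p0) /S flowS. Qed.

Let S1E j : S 1%N j = F 0%N j.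
Proof. by rewrite /S flowS flow0 add0r. Qed.

Let DT j : D p.-1 j = S p j - F p.-1 j.
Proof. by rewrite /balance prednK // SpE; lia. Qed.

Let DB j : D 0%N j = F 0%N j - S p j.
Proof. by rewrite /balance S1E /S flow0; lia. Qed.

Let odd_top j : odd (p.-1 + j) = odd j.
Proof. by rewrite oddD; move: op; rewrite -{1}(prednK p0) /=; case: odd. Qed.

(** The ends of a seam edge have the same colour and are read at the same cut, one with all other
    strands below and one with all others above. *)
Lemma odd_label_seam j : U p.-1 j.+1 -> L p.-1 j.+1 = - L 0 j.+1.
Proof.
move=> u; have [r1 r2] : R 0%N j = false /\ R 0%N j.+1 = false by have := RU0 j; lia.
have pp : (p.-1 < p)%N by rewrite prednK.
have [r3 r4] : R p.-1 j = false /\ R p.-1 j.+1 = false.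
  by have := RU p.-2 j; rewrite (_ : p.-2.+1 = p.-1) ?u; lia.
have B k : M 0 k -> D p.-1 k = - D 0%N k.
  move=> Mk; rewrite DT DB !FE // /M odd_top; move: Mk; rewrite /M add0n => -> /=; lia.
case: (boolP (odd j)) => o; first by rewrite !odd_labelB ?B // odd_top.
by rewrite !odd_labelW ?B // ?odd_top /M ?add0n.
Qed.

Let FM i j : (i < p)%N -> odd (i + j) -> F i j = 1.
Proof. by move=> ip o; rewrite FE // /M o. Qed.

Let absL0 j : odd j -> L 0 j = 1 - S p j /\ 2 <= S p j.
Proof.
move=> oj; rewrite odd_labelW // DB FM //; split=> //.
rewrite SpE FM ?prednK ?odd_top //.
have := @S_mono 1 p.-2 j; rewrite S1E FM // (_ : 1 + p.-2 = p.-1)%N; last lia.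
by move=> /(_ (leq_pred p)); lia.
Qed.

Let absL1 j : ~~ odd j -> `|L 1 j| <= S p j - 1.
Proof.
move=> oj; rewrite odd_labelW; last by rewrite add1n.
have S2 : S 2 j = F 0%N j + 1 by rewrite /S flowS -/S -/F S1E (FM (ltnW p2)).
rewrite /balance S1E S2; have := @S_mono 2 p.-2 j; rewrite S2 (_ : 2 + p.-2 = p)%N; last lia.
by move=> /(_ (leqnn p)); have := F0 j p0; lia.
Qed.

(** A seam edge changes the number [S p] of strands by 2 between columns [j] and [j + 1], the even
    one having fewer. In the odd column row 0 gives [d = S p - 1]; in the even column row 1 gives
    [d <= S p - 1], a contradiction. *)
Lemma odd_label_no_seam (d : int) : (forall i j, (i < p)%N -> `|L i j| = d) ->
  forall j, U p.-1 j.+1 = false.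
Proof.
move=> Ld j; apply/negP => u.
have := SV p j.+1; have := SV p j; rewrite VpE V0E u mulr1 /sgc add0n /=.
have := Ld 0%N j p0; have := Ld 0%N j.+1 p0.
have := Ld 1%N j (ltnW p2); have := Ld 1%N j.+1 (ltnW p2).
case: (boolP (odd j)) => o /=.
  have o1 : ~~ odd j.+1 by rewrite /= o.
  by have := absL1 o1; have [-> h] := absL0 o; lia.
have o1 : odd j.+1 by [].
by have := absL1 o; have [-> h] := absL0 o1; lia.
Qed.

(** At column 1 both the top and the bottom row carry a strand; their labels are [S p 1 - 1 > 0] and
    its negative. *)
Lemma odd_label_not_const : ~ (forall i j, (i < p)%N -> L i j = L 0 1).
Proof.
move=> Lc; have pp : (p.-1 < p)%N by rewrite prednK.
have := Lc _ 1%N pp; have [-> h] := absL0 (isT : odd 1).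
by rewrite odd_labelW ?odd_top // DT FM ?odd_top //; lia.
Qed.

End OddFlow.

(** * Brickwork with a vertical band *)

(* The matching for even p: vertical edges from row p - 1 to row 0, bricks in all other rows. *)
Definition band_rm (p i j : nat) : bool := (0 < i %% p < p.-1)%N && odd (i + j).
Definition band_um (p i j : nat) : bool := (i %% p == p.-1)%N.

Lemma modS_eq0 p i : (0 < p)%N -> (i.+1 %% p == 0)%N = (i %% p == p.-1)%N.
Proof.
move=> p0; have ip := ltn_pmod i p0.
rewrite modnS; case: (boolP (p %| i.+1)%N) => [|/negPf pi].
  rewrite -addn1 /dvdn -modnDml addn1 -/(dvdn _ _) => /dvdn_leq; lia.
have := ltn_pmod i.+1 p0; rewrite modnS pi; lia.
Qed.

Lemma band_exact p i j : (1 < p)%N ->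
  (band_rm p i.+1 j + band_rm p i.+1 j.+1 + band_um p i j.+1 + band_um p i.+1 j.+1 = 1)%N.
Proof.
move=> p1; rewrite /band_rm /band_um -modS_eq0; last lia.
have := ltn_pmod i.+1 (ltnW p1).
rewrite addnS /=; case: (odd _) => /=; lia.
Qed.

Lemma band_exact0 p j : (1 < p)%N ->
  (band_rm p 0%N j + band_rm p 0%N j.+1 + band_um p p.-1 j.+1 + band_um p 0%N j.+1 = 1)%N.
Proof. by move=> p1; rewrite /band_rm /band_um mod0n modn_small; lia. Qed.

(** * The height function for even [p] *)

Section EvenFlow.
Import GRing.Theory.
Local Open Scope ring_scope.
Variables (p q : nat) (R U : nat -> nat -> bool).
Hypotheses (p5 : (5 < p)%N) (ep : ~~ odd p) (oq : ~~ odd q) (q0 : (0 < q)%N).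
Hypothesis RU : forall i j, (R i.+1 j + R i.+1 j.+1 + U i j.+1 + U i.+1 j.+1 = 1)%N.
Hypothesis RU0 : forall j, (R 0%N j + R 0%N j.+1 + U p.-1 j.+1 + U 0%N j.+1 = 1)%N.
Hypothesis Rdisj : forall i j, (0 < i < p.-1)%N -> odd (i + j) -> R i j = false.
Hypothesis Udisj : forall j, U p.-1 j = false.
Hypothesis Rper : forall i j, R i (j + q)%N = R i j.

Let M := band_rm p.
Let Z := band_um p.
Let F := hflow R M.
Let V := vflow p U Z.
Let S := flow R M.

Let p0 : (0 < p)%N. Proof. by case: p p5. Qed.
Let p1 : (1 < p)%N. Proof. by apply: leq_trans p5. Qed.

Let odd_top j : odd (p.-1 + j) = ~~ odd j.
Proof. by rewrite oddD; move: ep; rewrite -{1}(prednK p0) /= negbK => ->. Qed.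

Let ME i j : (i < p)%N -> M i j = (0 < i < p.-1)%N && odd (i + j).
Proof. by move=> ip; rewrite /M /band_rm modn_small. Qed.

Let FE i j : (0 < i < p.-1)%N -> F i j = (odd (i + j) || R i j : nat)%:Z.
Proof.
move=> ip; have ip' : (i < p)%N by lia.
rewrite /F /hflow /sgc ME // ip /=.
by case: (boolP (odd _)) => [/(Rdisj ip)->|_] /=; lia.
Qed.

Let FEb i j : (i == 0)%N || (i == p.-1)%N -> F i j = sgc i j * (R i j : nat)%:Z.
Proof.
move=> ib; have ip : (i < p)%N by lia.
have nb : (0 < i < p.-1)%N = false by lia.
by rewrite /F /hflow ME // nb subr0.
Qed.

Let VE i j : (i.+1 < p)%N -> V i.+1 j = sgc i j * (U i j : nat)%:Z.
Proof.
move=> ip; rewrite /V /vflow /Z /band_um (modn_small (ltnW ip)).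
have -> : (i == p.-1) = false by lia.
by rewrite subr0.
Qed.

Let V0E j : V 0%N j = sgc 0 j.
Proof.
by rewrite /V /vflow /Z /band_um modn_small ?prednK // eqxx Udisj /= sub0r mulrN mulNr opprK mulr1.
Qed.

Let VpE j : V p j = sgc 0 j.
Proof.
rewrite -V0E -{1}(prednK p0) /V /vflow; congr (_ * _).
by rewrite /sgc odd_top add0n; case: odd.
Qed.

Let SV i j : S i j.+1 = S i j + V 0%N j.+1 - V i j.+1.
Proof. by apply: (flow_vflow RU RU0) => *; [exact: band_exact|exact: band_exact0]. Qed.

Let a : int := S p 0%N.

(** The seam flow leaving row [p - 1] enters at row 0, so the total flow is the same across every
    cut. *)
Let Sp j : S p j = a.
Proof. by elim: j => [|j <-] //; rewrite SV V0E VpE addrK. Qed.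

(** The height of the face above row [i] between columns [j] and [j + 1]. The first summand is the
    height of the face below row 0, which alternates because the seam flow does. *)
Let height i j : int := (if odd j then 0 else -1) + S i.+1 j.
Local Notation H := height.

Let HV i j : H i j.+1 = H i j - V i.+1 j.+1.
Proof. by rewrite /height SV V0E /sgc add0n /=; case: odd => /=; lia. Qed.

Let HS i j : H i.+1 j = H i j + F i.+1 j.
Proof. by rewrite /height /S flowS addrA. Qed.

Let Sper i j : (i <= p)%N -> S i (j + q) = S i j.
Proof.
have oE k : odd (k + q) = odd k by rewrite oddD (negPf oq) addbF.
elim: i => [|i IH] ip; first by rewrite /S !flow0.
rewrite /S !flowS -/S IH 1?ltnW // /hflow /sgc /M /band_rm Rper addnA oE //.
Qed.

Let Hper i j : (i < p)%N -> H i (j + q) = H i j.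
Proof.
have oE k : odd (k + q) = odd k by rewrite oddD (negPf oq) addbF.
by move=> ip; rewrite /height Sper // oE.
Qed.

(* The height of the face to the left of the M-edge at (i, j), modulo the total flow a. The
   vertical M-edges all have height 0 on their left, since the flow alternates along them. *)
Definition band_label i j : int :=
  if (0 < i < p.-1)%N then ((if odd (i + j) then H i j else H i (j + q).-1) %% a)%Z else 0.
Local Notation L := band_label.

Let LW i j : (0 < i < p.-1)%N -> odd (i + j) -> L i j = (H i j %% a)%Z.
Proof. by rewrite /L => -> ->. Qed.

Let LB i j : (0 < i < p.-1)%N -> odd (i + j) -> L i j.+1 = (H i j %% a)%Z.
Proof. by move=> ip o; rewrite /L ip addnS /= o /= Hper //; lia. Qed.

Let L0 i j : (0 < i < p.-1)%N = false -> L i j = 0.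
Proof. by rewrite /L => ->. Qed.

Lemma band_label_per i j : (i < p)%N -> L i (j + q) = L i j.
Proof.
move=> ip; rewrite /L addnA [odd (i + j + q)]oddD (negPf oq) addbF.
by rewrite (_ : (j + q + q).-1 = (j + q).-1 + q)%N ?Hper //; lia.
Qed.

Lemma band_label_h i j : (i < p)%N -> M i j.+1 || R i j.+1 -> L i j.+1 = L i j.+2.
Proof.
move=> ip; rewrite ME //; case: (boolP (0 < i < p.-1)%N) => [ib|/negPf ib]; last by rewrite !L0.
case: (boolP (odd (i + j.+1))) => [o _|o /= r]; first by rewrite LW // LB.
have o' : odd (i + j) by move: o; rewrite addnS /= negbK.
rewrite LB // LW ?addnS ?o' //; last by rewrite /= o'.
have u1 : U i j.+1 = false by case: (i) r => [|k] r; [have := RU0 j|have := RU k j]; lia.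
have u2 : U i j.+2 = false by case: (i) r => [|k] r; [have := RU0 j.+1|have := RU k j.+1]; lia.
by rewrite !HV !VE ?u1 ?u2 ?mulr0 ?subr0 //; lia.
Qed.

Let vused i j : (i.+1 < p)%N -> U i j.+1 ->
  [/\ R i j = false, R i j.+1 = false, R i.+1 j = false, R i.+1 j.+1 = false & U i.+1 j.+1 = false].
Proof.
move=> ip u.
have [-> ->] : R i j = false /\ R i j.+1 = false.
  by case: (i) u => [|k] u; [have := RU0 j|have := RU k j]; lia.
by have := RU i j; split; lia.
Qed.

Let sgcE i j : sgc i j = if odd (i + j) then -1 else 1. Proof. by []. Qed.

Lemma band_label_v i j : (i.+1 < p)%N -> U i j.+1 -> L i j.+1 = L i.+1 j.+1.
Proof.
move=> ip u; have [r1 r2 r3 r4 u2] := vused ip u.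
have V1 : V i.+1 j.+1 = sgc i j.+1 by rewrite VE // u mulr1.
have h := HV i j; rewrite V1 sgcE addnS /= in h.
case: (posnP i) => [i0|ib].
  rewrite L0 ?i0 //; have b1 : (0 < 1 < p.-1)%N by lia.
  (* Without an N-edge in row 0 at this cut, the face above row 0 has the height of the face below
     it. *)
  have H0 k : R 0%N k = false -> H 0%N k = if odd k then 0 else -1.
    by move=> rk; rewrite /height /S flowS flow0 add0r -/F FEb // rk mulr0 addr0.
  rewrite {}i0 in r2 r4 u2 *.
  case: (boolP (odd j)) => o.
    have o1 : odd (1 + j.+1) by rewrite add1n /= negbK.
    by rewrite LW // HS H0 // (FE _ b1) o1 /= o /= mod0z.
  have o1 : odd (1 + j.+1) = false by rewrite add1n /= negbK; apply/negbTE.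
  have o2 : odd (1 + j) by rewrite add1n.
  have V2 : V 2%N j.+1 = 0 by rewrite VE ?u2 ?mulr0 //; lia.
  rewrite LB // -[H _ _](subrK (V 2%N j.+1)) -HV V2 HS H0 // (FE _ b1) o1 r4 /= (negPf o).
  by rewrite mod0z.
case: (ltnP i.+1 p.-1) => it; last first.
  (* Just below row [p - 1] the height is the seam height plus [a]; this is why labels are taken
     modulo [a]. *)
  have iE : i = p.-2 by lia.
  have i1E : i.+1 = p.-1 by lia.
  have b1 : (0 < i < p.-1)%N by lia.
  have oi k : odd (i + k) = odd k.
    by have := odd_top k; rewrite -i1E addSn /= => /negbRL; rewrite negbK.
  have Hi : H i j.+1 = (if odd j.+1 then 0 else -1) + a.
    have FT : F i.+1 j.+1 = 0 by rewrite FEb ?r4 ?mulr0 // i1E eqxx orbT.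
    rewrite /height; congr (_ + _).
    by rewrite -(Sp j.+1) -{1}(prednK p0) -i1E /S [flow _ _ i.+2 _]flowS -/F FT addr0.
  rewrite [RHS]L0; last by lia.
  case: (boolP (odd j)) => o.
    rewrite LB ?oi // ; move: h; rewrite Hi oi /= o /= => h.
    by rewrite (_ : H i j = a) ?modzz //; lia.
  by rewrite LW ?oi //= Hi /= o add0r modzz.
have b1 : (0 < i < p.-1)%N by lia.
have b2 : (0 < i.+1 < p.-1)%N by lia.
case: (boolP (odd (i + j))) => o; rewrite ?o ?(negPf o) /= in h.
  rewrite LB // LW ?addnS ?addSn /= ?negbK // HS FE // addSn addnS /= negbK o.
  by rewrite h; congr (_ %% _)%Z; lia.
rewrite LW ?addnS //= LB // HS FE // addSn /= o h; congr (_ %% _)%Z; lia.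
Qed.

Let F0 i j : (0 < i < p.-1)%N -> 0 <= F i j.
Proof. by move=> ip; rewrite FE. Qed.

Let FM i j : (0 < i < p.-1)%N -> odd (i + j) -> F i j = 1.
Proof. by move=> ip o; rewrite FE // o. Qed.

Let S_mono i k j : (0 < i)%N -> (i + k <= p.-1)%N -> S i j <= S (i + k) j.
Proof.
move=> i0; elim: k => [|k IH] ik; first by rewrite addn0.
rewrite addnS in ik *; rewrite /S flowS -/S -/F.
by have := @F0 (i + k) j; have := IH (ltnW ik); lia.
Qed.

(** All strands now have height divisible by [a] on their left, while two vertically consecutive
    strands differ in height by 1. *)
Lemma band_flow_dvd1 : (forall i j, (i < p)%N -> L i j = 0) -> (a %| 1)%Z.
Proof.
move=> Lc.
have b k : (0 < k < 5)%N -> (0 < k < p.-1)%N by lia.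
have d1 : (a %| H 1%N 2%N)%Z.
  by apply/dvdz_mod0P; rewrite -LW ?Lc ?b.
(* The next strand above row 1 has height one more, whether it is in row 2 or in row 3. *)
suff : (a %| H 1%N 2%N + 1)%Z by rewrite rpredDl.
case r : (R 2%N 2%N).
  have -> : H 1%N 2%N + 1 = H 2%N 1%N.
    have u : U 2%N 2%N = false by have := RU 1 1; lia.
    have := HV 2 1; rewrite VE ?u ?mulr0 ?subr0 => [<-|]; last by lia.
    by rewrite (HS 1 2) (FE _ (b 2 isT)) r.
  by apply/dvdz_mod0P; rewrite -LB ?Lc ?b //; lia.
have -> : H 1%N 2%N + 1 = H 3%N 2%N.
  by rewrite (HS 2 2) (HS 1 2) (FE _ (b 2 isT)) (FE _ (b 3 isT)) r addr0.
by apply/dvdz_mod0P; rewrite -LW ?Lc ?b //; lia.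
Qed.

(** At each cut rows 0 and [p - 1] have opposite colours, so only one of them can carry flow to the
    left. As [a <= 1], this must be an N-edge of row 0 in odd columns and of row [p - 1] in even
    ones; these edges cover both rows. *)
Lemma band_isolated : (a %| 1)%Z -> forall j, U 0%N j.+1 = false /\ U p.-2 j.+1 = false.
Proof.
rewrite dvdz1 => a1.
have aE j : 2 + F 0%N j + F p.-1 j <= a.
  rewrite -(Sp j) -{2}(prednK p0) /S flowS -/F -/S.
  have S1 : S 1%N j = F 0%N j by rewrite /S flowS flow0 add0r.
  suff : 2 + F 0%N j <= S p.-1 j by lia.
  (* The two units come from the M-edges in rows 2 and 4, or 1 and 3, which are brick rows as
     [p >= 6]. *)
  case: (boolP (odd j)) => o.
    have := @S_mono 5 (p.-1 - 5) j isT; rewrite (_ : 5 + (p.-1 - 5) = p.-1)%N; last lia.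
    have -> : S 5%N j = F 0%N j + F 1%N j + F 2%N j + F 3%N j + F 4%N j by rewrite /S !flowS flow0 add0r.
    rewrite (@FM 2) ?(@FM 4) //; try lia.
    by have := @F0 1 j; have := @F0 3 j; lia.
  have := @S_mono 4 (p.-1 - 4) j isT; rewrite (_ : 4 + (p.-1 - 4) = p.-1)%N; last lia.
  have -> : S 4%N j = F 0%N j + F 1%N j + F 2%N j + F 3%N j by rewrite /S !flowS flow0 add0r.
  rewrite (@FM 1) ?(@FM 3) //; try lia.
  by have := @F0 2 j; lia.
have RR j : if odd j then R 0%N j else R p.-1 j.
  have := aE j; rewrite !FEb ?eqxx ?orbT // !sgcE odd_top add0n.
  by case: odd => /=; do 2 case: (R _ j) => //; lia.
move=> j; have := RR j; have := RR j.+1 => /=.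
have := RU0 j; have := RU p.-2 j.
rewrite (_ : p.-2.+1 = p.-1) ?Udisj; last lia.
by case: odd => /= r1 r2; lia.
Qed.
End EvenFlow.

(** * The torus C_4 x C_4 *)

Definition code44 i j := 4 * (i %% 4) + j %% 4.

Definition nbr44 n :=
  let i := n %/ 4 in let j := n %% 4 in
  [:: code44 i (j + 3); code44 i j.+1; code44 (i + 3) j; code44 i.+1 j].

Arguments nbr44 : simpl never.

(** [s] is the path so far, last vertex [x] first. Each step appends a neighbour [y] of [x] and then
    the partner of [y]; [has_ham] checks the outcome independently. *)
Fixpoint find_ham (m : seq nat) (fuel : nat) (s : seq nat) (x : nat) : option (seq nat) :=
  if fuel is fuel'.+1 then
    foldr (fun y r => if y \in s then r else
                      if find_ham m fuel' [:: nth 0 m y, y & s] (nth 0 m y) is Some s' then Some s'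
                      else r) None (nbr44 x)
  else if 0 \in nbr44 x then Some s else None.

Definition has_ham (m : seq nat) : bool :=
  if find_ham m 7 [:: nth 0 m 0; 0] (nth 0 m 0) is Some s then
    [&& uniq s, size s == 16, all (gtn 16) s, cycle [rel x y | y \in nbr44 x] s &
        all (fun x => (next s x == nth 0 m x) || (prev s x == nth 0 m x)) s]
  else false.

(* l lists the unmatched vertices, m the partners of the others. *)
Fixpoint all_ham (fuel : nat) (l m : seq nat) : bool :=
  if fuel is fuel'.+1 then
    if l is x :: l' then
      all (fun y => if y \in l' then all_ham fuel' (rem y l') (set_nth 0 (set_nth 0 m x y) y x)
                    else true) (nbr44 x)
    else has_ham m
  else false.

Lemma all_hamS fuel x l m : all_ham fuel.+1 (x :: l) m =
  all (fun y => if y \in l then all_ham fuel (rem y l) (set_nth 0 (set_nth 0 m x y) y x)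
                else true) (nbr44 x).
Proof. by []. Qed.

(** Fuel 9 allows for eight matching edges and the final test; the zeros are placeholders. *)
Lemma all_ham44 : all_ham 9 (iota 0 16) (nseq 16 0).
Proof. by vm_compute. Qed.

(** Follow the branch [y = mu x] of the search: [l] stays closed under [mu], and [m] agrees with
    [mu] outside [l]. *)
Lemma all_ham_sound (mu : nat -> nat) :
  (forall n, n < 16 -> [/\ mu n < 16, mu (mu n) = n, mu n != n & mu n \in nbr44 n]) ->
  forall fuel l m, uniq l -> (forall n, n \in l -> n < 16 /\ mu n \in l) -> size m = 16 ->
  (forall n, n < 16 -> n \notin l -> nth 0 m n = mu n) ->
  all_ham fuel l m -> has_ham (mkseq mu 16).
Proof.
move=> muP; elim=> // fuel IH [|x l] m ul lP sm mP.
  suff -> : m = mkseq mu 16 by [].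
  apply: (@eq_from_nth _ 0) => [|i]; rewrite ?size_mkseq // sm => i16.
  by rewrite nth_mkseq // mP.
have [x16 mux] := lP x (mem_head _ _).
have [mux16 mumux muxx muxn] := muP x x16.
have muxl : mu x \in l by move: mux; rewrite inE (negPf muxx).
rewrite all_hamS => /allP/(_ _ muxn); rewrite muxl; apply: IH.
- by apply: rem_uniq; case/andP: ul.
- have ul' : uniq l by case/andP: ul.
  move=> n; rewrite mem_rem_uniq // inE => /andP[nmux nl].
  have [n16 munl] : n < 16 /\ mu n \in x :: l by apply: lP; rewrite inE nl orbT.
  have [_ mumun _ _] := muP n n16.
  split=> //; rewrite mem_rem_uniq // inE; apply/andP; split.
    apply/eqP => E; have nx : n = x by rewrite -mumun E.
    by case/andP: ul; rewrite -nx nl.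
  move: munl; rewrite inE => /orP[/eqP E|//].
  by move: nmux; rewrite -E mumun eqxx.
- by rewrite !size_set_nth sm; lia.
move=> n n16; rewrite mem_rem_uniq; last by case/andP: ul.
rewrite inE negb_and negbK !nth_set_nth /= !nth_set_nth /=.
have [->|nmux] /= := eqVneq n (mu x); first by rewrite ?eqxx mumux.
have [->//|nx] /= := eqVneq n x => nl.
by apply: mP; rewrite // inE negb_or nx.
Qed.

Section Torus44.
Variables (T : finType) (e : rel T) (v : nat -> nat -> T) (c : T -> nat * nat).
Hypothesis G : grid e 4 4 v c.

Let code x := 4 * (c x).1 + (c x).2.
Let w n := v (n %/ 4) (n %% 4).

Let code_v i j : code (v i j) = code44 i j.
Proof. by rewrite /code (grid_coord1 G) (grid_coord2 G). Qed.

Let codeK : cancel code w.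
Proof.
move=> x; have [h1 h2 h3] := grid_coord G x.
by rewrite -[RHS]h3 /w /code; congr (v _ _); lia.
Qed.

Let wK n : n < 16 -> code (w n) = n.
Proof. by move=> n16; rewrite code_v /code44; lia. Qed.

Let code_inj : injective code := can_inj codeK.

Let code16 x : code x < 16.
Proof. by have [h1 h2 h3] := grid_coord G x; rewrite /code; lia. Qed.

Let code_adj x y : e x y = (code y \in nbr44 (code x)).
Proof.
rewrite -(codeK x) wK ?code16 //; set n := code x.
set i := n %/ 4; set j := n %% 4.
have -> : w n = v (i + 3).+1 (j + 3).+1.
  by apply/eqP; rewrite (grid_eq G) -!addnS !modnDr !eqxx.
have -> : nbr44 n = map code [:: v i (j + 3); v i j.+1; v (i + 3) j; v i.+1 j].
  by rewrite /= !code_v.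
rewrite (mem_map code_inj) (grid_adj G).
by congr (_ \in [:: _; _; _; _]); apply/eqP; rewrite (grid_eq G); apply/andP; split; lia.
Qed.

Lemma grid44_PMH : PMH_property e.
Proof.
have eirr : irreflexive e by apply: grid_irr G _ _.
have esym := grid_sym G.
split.
  exists (grid_matching 4 4 v (fun i j => odd j) (fun i j => false)).
  apply: (grid_matching_pm G) => // i j; first by rewrite odd_mod.
  by rewrite /=; case: odd.
move=> M pM.
have partner x : exists y, [/\ e x y & [set x; y] \in M].
  have [E EM xE] := pm_edgeP x pM.
  have [y exy Ey] := is_edge_end esym (pM.1 E EM) xE.
  by exists y; rewrite -Ey.
(* By [partner], the default [x] is never returned. *)
pose pr x := odflt x [pick y | e x y && ([set x; y] \in M)].
have prP x : e x (pr x) /\ [set x; pr x] \in M.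
  rewrite /pr; case: pickP => [y /andP[]//|h].
  by have [y [exy yM]] := partner x; move: (h y); rewrite exy yM.
have prE x y : [set x; y] \in M -> e x y -> pr x = y.
  move=> xyM exy; have [exp xpM] := prP x.
  have := pm_edge_uniq pM xyM xpM (set21 _ _) (set21 _ _).
  move=> E; have : pr x \in [set x; y] by rewrite E set22.
  by rewrite !inE => /orP[]/eqP // px; move: exp; rewrite px eirr.
have prK x : pr (pr x) = x.
  have [exp xpM] := prP x; apply: prE; by [rewrite setUC|rewrite esym].
pose mu n := code (pr (w n)).
have muc x : mu (code x) = code (pr x) by rewrite /mu codeK.
have muP n : n < 16 -> [/\ mu n < 16, mu (mu n) = n, mu n != n & mu n \in nbr44 n].
  move=> n16; have [exp _] := prP (w n).
  have e1 : mu n = code (pr (w n)) by [].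
  split; rewrite e1 ?muc ?prK ?wK //.
    by apply/eqP => /(congr1 w); rewrite codeK => px; move: exp; rewrite px eirr.
  by rewrite -{2}(wK n16) -code_adj.
have : has_ham (mkseq mu 16).
  apply: (all_ham_sound muP (iota_uniq 0 16) _ (size_nseq 16 0) _ all_ham44) => n.
    by rewrite !mem_iota => n16; have [] := muP n n16.
  by rewrite mem_iota => /= ->.
rewrite /has_ham; case: find_ham => // s /and5P[us /eqP ss /allP s16 cs /allP sm].
pose t := map w s.
have st : s = map code t.
  by rewrite -map_comp -[LHS]map_id; apply/eq_in_map => n /s16 /= n16; rewrite wK.
have ut : uniq t by rewrite -(map_inj_uniq code_inj) -st.
have sall n : n < 16 -> n \in s.
  move=> n16; have [||_ ->] := @uniq_min_size _ s (iota 0 16) us _ _.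
  - by move=> k /s16; rewrite mem_iota.
  - by rewrite ss size_iota.
  - by rewrite mem_iota.
have tP x : x \in t by rewrite -(mem_map code_inj) -st sall.
apply: (extends_to_hamI eirr pM ut tP).
- by rewrite size_map ss.
- move: cs; rewrite st; case: (t) => //= x0 t'; rewrite -map_rcons path_map.
  by apply: sub_path => x y; rewrite /= -code_adj.
move=> E EM.
have [x xE] : exists x, x \in E.
  have /existsP[a /existsP[b /andP[_ /eqP->]]] := pM.1 E EM; exists a; exact: set21.
have [y exy Ey] := is_edge_end esym (pM.1 E EM) xE.
have py : pr x = y by apply: prE; rewrite -?Ey.
have := sm (code x) (sall _ (code16 x)).
rewrite nth_mkseq ?code16 // muc py st next_map // prev_map //.
case/orP=> /eqP/code_inj yE.
  by exists x; rewrite ?yE // ?tP.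
by exists y; rewrite ?tP // Ey -yE next_prev // setUC.
Qed.

End Torus44.

(** * The characterisation *)

Section NotPMH.
Variables (T : finType) (e : rel T) (p q : nat) (v : nat -> nat -> T) (c : T -> nat * nat).
Hypotheses (G : grid e p q v c) (p2 : 2 < p) (q2 : 2 < q) (oq : ~~ odd q).

Let hedge_per i j : hedge v i (j + q) = hedge v i j.
Proof. by rewrite /hedge -addSn; congr [set _; _]; apply/eqP; rewrite (grid_eq G) modnDr !eqxx. Qed.

Let p0 : 0 < p. Proof. exact: ltn_trans p2. Qed.

Let pm_grid0 (N : {set {set T}}) j : perfect_matching e N ->
  (hedge v 0 j \in N) + (hedge v 0 j.+1 \in N)
  + (vedge v p.-1 j.+1 \in N) + (vedge v 0 j.+1 \in N) = 1.
Proof.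
move=> pN; rewrite -(pm_grid G p2 q2 p.-1 j pN) prednK //.
have v0 k : v p k = v 0 k by apply/eqP; rewrite (grid_eq G) modnn mod0n !eqxx.
have v1 k : v p.+1 k = v 1 k by apply/eqP; rewrite (grid_eq G) eqn_modS modnn mod0n !eqxx.
by rewrite /hedge /vedge prednK // !v0 v1.
Qed.

Lemma grid_odd_not_PMH : odd p -> ~ PMH_property e.
Proof.
move=> op [_ PM].
(* For odd [p] the parity of [i + j] is not periodic in [i]; reducing [i] modulo [p] puts the clash
   at the seam. *)
pose RM i j := odd (i %% p + j); pose UM (i j : nat) := false.
have RM_mod i j : RM (i %% p) (j %% q) = RM i j.
  by rewrite /RM modn_mod !oddD (odd_mod _ (negPf oq)).
have UM_mod i j : UM (i %% p) (j %% q) = UM i j by [].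
have RUM i j : RM i.+1 j + RM i.+1 j.+1 + UM i j.+1 + UM i.+1 j.+1 = 1.
  by rewrite /RM /UM addnS /=; case: (odd _).
have [N [pN hH]] := PM _ (grid_matching_pm G p2 q2 RM_mod UM_mod RUM).
have RE i j : i < p -> RM i j = odd (i + j) by move=> ip; rewrite /RM modn_small.
pose R i j := hedge v i j \in N; pose U i j := vedge v i j \in N.
have RU i j : R i.+1 j + R i.+1 j.+1 + U i j.+1 + U i.+1 j.+1 = 1 := pm_grid G p2 q2 i j pN.
have RU0 j : R 0 j + R 0 j.+1 + U p.-1 j.+1 + U 0 j.+1 = 1 := pm_grid0 j pN.
have Rdisj i j : i < p -> odd (i + j) -> R i j = false.
  by move=> ip o; have [] := ham_grid_disjoint G p2 q2 RM_mod UM_mod RUM pN hH i j; rewrite RE // o.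
have Rper i j : R i (j + q) = R i j by rewrite /R hedge_per.
have q0 : 0 < q by apply: ltn_trans q2.
pose L := odd_label p q R.
have Lper i j : i < p -> L i (j + q) = L i j by move=> ip; apply: odd_label_per.
have Lh i j : i < p -> RM i j.+1 || R i j.+1 -> L i j.+1 = L i j.+2.
  by move=> ip; rewrite RE //; apply: (odd_label_h p2 op oq RU RU0).
have Lv i j : i.+1 < p -> UM i j.+1 || U i j.+1 -> L i j.+1 = L i.+1 j.+1.
  by move=> ip; apply: (odd_label_v p2 op oq RU RU0).
have lab := ham_grid_label G p2 q2 RM_mod UM_mod pN hH.
(* Crossing the seam flips the sign of [L], so at first only its absolute value is an invariant. *)
have no_seam : forall j, U p.-1 j.+1 = false.
  apply: (odd_label_no_seam p2 op oq RU RU0 Rdisj q0 (d := `|L 0 0|%R)) => i j ip.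
  apply: (lab _ (fun i j => `|L i j|%R)) => // [{}i {}j {}ip|{}i {}j {}ip h|{}i {}j {}ip h|{}j h].
  - by rewrite Lper.
  - by rewrite (Lh _ _ ip h).
  - by rewrite (Lv _ _ ip h).
  - by rewrite /L (odd_label_seam p2 op oq RU RU0 Rdisj Rper q0) // Num.Theory.normrN.
apply: (odd_label_not_const p2 op oq Rdisj q0) => i j ip.
apply: lab => // {}j; rewrite /UM -/(U _ _) no_seam //.
Qed.

Lemma grid_even_not_PMH : ~~ odd p -> 5 < p -> ~ PMH_property e.
Proof.
move=> ep p5 [_ PM].
pose RM := band_rm p; pose UM := band_um p.
have RM_mod i j : RM (i %% p) (j %% q) = RM i j.
  by rewrite /RM /band_rm modn_mod !oddD (odd_mod _ (negPf oq)) (odd_mod _ (negPf ep)).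
have UM_mod i j : UM (i %% p) (j %% q) = UM i j by rewrite /UM /band_um modn_mod.
have p1 : 1 < p := ltnW p2.
have RUM i j : RM i.+1 j + RM i.+1 j.+1 + UM i j.+1 + UM i.+1 j.+1 = 1 by apply: band_exact.
have [N [pN hH]] := PM _ (grid_matching_pm G p2 q2 RM_mod UM_mod RUM).
pose R i j := hedge v i j \in N; pose U i j := vedge v i j \in N.
have RU i j : R i.+1 j + R i.+1 j.+1 + U i j.+1 + U i.+1 j.+1 = 1 := pm_grid G p2 q2 i j pN.
have RU0 j : R 0 j + R 0 j.+1 + U p.-1 j.+1 + U 0 j.+1 = 1 := pm_grid0 j pN.
have pp : p.-1 < p by rewrite prednK.
have dis := ham_grid_disjoint G p2 q2 RM_mod UM_mod RUM pN hH.
have Rdisj i j : 0 < i < p.-1 -> odd (i + j) -> R i j = false.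
  move=> ip o; have [] := dis i j; rewrite /RM /band_rm modn_small ?ip ?o //; lia.
have Udisj j : U p.-1 j = false.
  by have [_] := dis p.-1 j; rewrite /UM /band_um modn_small // eqxx.
have Rper i j : R i (j + q) = R i j by rewrite /R hedge_per.
have q0 : 0 < q by apply: ltn_trans q2.
have lab := ham_grid_label G p2 q2 RM_mod UM_mod pN hH.
have UME i j : i.+1 < p -> UM i j = false.
  by move=> ip; rewrite /UM /band_um modn_small; lia.
pose L := band_label p q R.
have L0 j : L 0 j = 0%R by [].
have Lp j : L p.-1 j = 0%R by rewrite /L /band_label ltnn andbF.
have a1 : (flow R (band_rm p) p 0 %| 1)%Z.
  apply: (band_flow_dvd1 p5 ep oq q0 RU RU0 Rdisj Udisj Rper) => i j ip.
  rewrite -(L0 0); apply: (lab _ L) => // [{}i {}j {}ip|{}i {}j {}ip|{}i {}j {}ip].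
  - exact: band_label_per.
  - exact: (band_label_h p5 ep oq q0 RU RU0 Udisj Rper).
  - by rewrite UME // => /(band_label_v p5 ep oq q0 RU RU0 Rdisj Udisj Rper); apply.
have iso := band_isolated p5 ep oq q0 RU RU0 Rdisj Udisj a1.
(* By [iso], no edge joins rows 0 and [p - 1] to the other rows, so lying strictly between them is
   an invariant; rows 0 and 1 contradict this. *)
suff : (0 < 0 < p.-1) = (0 < 1 < p.-1) by lia.
apply: (lab _ (fun i _ => 0 < i < p.-1) _ _ _ _ 0 0 1 0) => // [i j ip|j _]; last by lia.
rewrite UME //= -/(U _ _) => u; have [u0 u1] := iso j.
have i0 : i != 0 by apply/eqP => E; rewrite E u0 in u.
have i1 : i != p.-2 by apply/eqP => E; rewrite E u1 in u.
lia.
Qed.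

End NotPMH.

(** Transposition lets either side play the role of the even [q]. *)
Lemma grid_swap (T : finType) (e : rel T) p q v c :
  grid e p q v c -> grid e q p (fun i j => v j i) (fun x => ((c x).2, (c x).1)).
Proof.
case=> gE gc gs ga; split=> // [i j i' j'|x|i j w].
- by rewrite gE andbC.
- by have [] := gc x.
- by rewrite ga !inE orbA orbC !orbA.
Qed.

Lemma torus_grid p q : 2 < p -> 2 < q ->
  exists v c, grid (box_product (cycle_graph p) (cycle_graph q)) p q v c.
Proof.
move=> p2 q2; have p0 : 0 < p by lia. have q0 : 0 < q by lia.
exists (fun i j => (Ordinal (ltn_pmod i p0), Ordinal (ltn_pmod j q0))).
exists (fun x => (val x.1, val x.2)); split=> [i j i' j'|[x y]|[x y] [x' y']|i j [x y]].
- by rewrite xpair_eqE -!val_eqE.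
- by split=> //=; congr (_, _); apply: val_inj; rewrite /= modn_small.
- by rewrite /box_product /cycle_graph /= (orbC (val y == _)) (orbC (val x == _)) (eq_sym x) (eq_sym y).
rewrite /box_product /cycle_graph !inE !xpair_eqE -!val_eqE /=.
have S n k m : 0 < n -> k < n -> ((m.+1 %% n == k.+1 %% n) = (k == m %% n))
  * ((k == (m.+1 %% n).+1 %% n) = (k == m.+2 %% n)).
  move=> n0 kn; split; first by rewrite eqn_modS (modn_small kn) eq_sym.
  by rewrite -[(m.+1 %% n).+1]addn1 modnDml addn1.
rewrite !S // (eq_sym _ (val x)) (eq_sym _ (val y)).
by case: (val x == _); case: (val y == _); case: (val x == _); case: (val x == _);
  case: (val y == _); case: (val y == _).
Qed.

Theorem mainTheorem2 (p q : nat) :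
  3 <= p -> 3 <= q ->
  (PMH_property (box_product (cycle_graph p) (cycle_graph q)) <-> (p = 4 /\ q = 4)).
Proof.
move=> p2 q2; have [v [c G]] := torus_grid p2 q2.
split; last by case=> pE qE; subst p q; exact: grid44_PMH G.
move=> PMH; have G' := grid_swap G.
case: (boolP (odd q)) => oq; case: (boolP (odd p)) => op.
- have [M pM] := PMH.1.
  have := pm_even (grid_irr G p2 q2) pM.
  by rewrite card_prod !card_ord oddM op oq.
- by case: (grid_odd_not_PMH G' q2 p2 op oq PMH).
- by case: (grid_odd_not_PMH G p2 q2 oq op PMH).
case: (ltnP 5 p) => p5; first by case: (grid_even_not_PMH G p2 q2 oq op p5 PMH).
case: (ltnP 5 q) => q5; first by case: (grid_even_not_PMH G' q2 p2 op oq q5 PMH).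
(* Both sides are even and between 3 and 5. *)
lia.
Qed.
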